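(* Let $b\ge 2$ be an integer and let $X$ be a Benford variable (base $b$). For $k\ge1$ let $A_{(k)}=\lfloor b^{\{\log_b X\}+k-1}\rfloor$ be its $k$-th integer significand, with support $\mathcal{A}_{(k)}=\{b^{k-1},\ldots,b^k-1\}$. Then $$\lim_{\substack{k\to\infty,\\ a\in\mathcal{A}_{(k)}}} a\,\Pr(A_{(k)}=a)=(\ln b)^{-1},$$ that is, for every sequence $(a_k)_{k\ge1}$ with $a_k\in\mathcal{A}_{(k)}$ for all $k$, $a_k\Pr(A_{(k)}=a_k)\to(\ln b)^{-1}$ as $k\to\infty$.
   Context: A Benford variable (base $b$) is a positive continuous random variable $X$ such that the fractional part $\{\log_b X\}$ is uniformly distributed on $(0,1)$, where $\{z\}=z-\lfloor z\rfloor$. *)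

(* Defs.v *)
From HB Require Import structures.
From mathcomp Require Import all_boot all_order all_algebra.
From mathcomp Require Import all_classical all_reals all_analysis.
From mathcomp Require Import measurable_realfun.

Set Implicit Arguments.
Unset Strict Implicit.
Unset Printing Implicit Defensive.

Import Order.TTheory GRing.Theory Num.Theory.
Import numFieldNormedType.Exports.

Local Open Scope classical_set_scope.
Local Open Scope ring_scope.

Definition frac (R : realType) (x : R) : R := x - (Num.floor x)%:~R.

Definition logb (R : realType) (b : nat) (x : R) : R := ln x / ln b%:R.

Definition frac_logb d (T : measurableType d) (R : realType)
    (P : probability T R) (b : nat) (X : {RV P >-> R}) (w : T) : R :=
  frac (logb b (X w)).

Lemma measurable_frac_logb d (T : measurableType d) (R : realType)
    (P : probability T R) (b : nat) (X : {RV P >-> R}) :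
  measurable_fun [set: T] (frac_logb b X).
Proof.
have mfloor : measurable_fun [set: R] (fun x : R => (Num.floor x)%:~R : R).
  apply: nondecreasing_measurable => // x y xy.
  by rewrite ler_int; apply: le_floor.
have mlog : measurable_fun [set: T] (fun w => logb b (X w)).
  apply: measurable_funM => //.
  by apply: measurableT_comp => //; exact: measurable_ln.
apply: measurable_funB => //.
exact: (measurableT_comp mfloor mlog).
Qed.

HB.instance Definition _ d (T : measurableType d) (R : realType)
    (P : probability T R) (b : nat) (X : {RV P >-> R}) :=
  isMeasurableFun.Build _ _ T R (frac_logb b X) (measurable_frac_logb b X).

(* Positivity is almost sure, since X only matters through its law (the library
   sets ln x = 0 for x <= 0). "Continuous" means that the distribution function
   is continuous; given the uniformity clause this is equivalent to absolute
   continuity of the law of X. uniform_prob lives on [0, 1], which is the same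
   law as the uniform law on (0, 1). *)
Definition benford d (T : measurableType d) (R : realType)
    (P : probability T R) (b : nat) (X : {RV P >-> R}) : Prop :=
  [/\ {ae P, forall w, 0 < X w},
      continuous (cdf X) &
      forall U : set R, measurable U ->
        distribution P (frac_logb b X) U = uniform_prob (@ltr01 R) U].

Definition int_significand d (T : measurableType d) (R : realType)
    (P : probability T R) (b : nat) (X : {RV P >-> R}) (k : nat) (w : T) : int :=
  Num.floor (b%:R `^ (frac_logb b X w + k%:R - 1)).

Definition significand_support (b k : nat) : set int :=
  [set a : int | b%:Z ^+ (k - 1)%N <= a <= b%:Z ^+ k - 1].

(* Main.v *)
Require Import Defs.
From mathcomp Require Import all_boot all_order all_algebra.
From mathcomp Require Import all_classical all_reals all_analysis.
From mathcomp Require Import ring lra.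

Import Order.TTheory GRing.Theory Num.Theory.
Import numFieldNormedType.Exports.

Local Open Scope classical_set_scope.
Local Open Scope ring_scope.

(** Write U for the fractional part of log_b X.  Since the floor of
    b^(U + k - 1) equals a exactly when a <= b^(U + k - 1) < a + 1, taking
    logarithms turns the event A_(k) = a into U lying in the half-open interval
    from log_b a - (k - 1) to log_b (a + 1) - (k - 1)
    ([int_significand_preimage]).  For a in the support of A_(k) this interval
    is contained in [0, 1], so uniformity of U makes its probability its
    length ([benford_int_significand_prob]):

      Pr(A_(k) = a) = (ln (a + 1) - ln a) / ln b.

    By [ln_succ_ge] and [ln_succ_le], ln (a + 1) - ln a lies between
    1 / (a + 1) and 1 / a, so a Pr(A_(k) = a) lies between
    (1 - 1 / (a + 1)) / ln b and 1 / ln b.  The least element b^(k-1) of the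
    support is at least k, so these bounds differ by at most a multiple of
    1 / (k + 1) whatever the choice of a ([benford_int_significand_bounds]), and
    the limit follows by squeezing. *)

Section Logarithms.
Context {R : realType}.
Implicit Types x y : R.

Lemma ln_succ_le x : 0 < x -> ln (x + 1) - ln x <= x^-1.
Proof.
move=> x0; rewrite -ln_div ?posrE//; last by lra.
rewrite mulrDl mul1r divff ?gt_eqF//.
by apply: le_ln1Dx; apply: lt_trans (_ : 0 < _); rewrite ?invr_gt0//; lra.
Qed.

(** The same tangent-line bound ln (1 + t) <= t, used at t = - 1 / (x + 1). *)
Lemma ln_succ_ge x : 0 < x -> (x + 1)^-1 <= ln (x + 1) - ln x.
Proof.
move=> x0; have x10 : 0 < x + 1 by lra.
rewrite -[leRHS]opprB lerNr -ln_div ?posrE//.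
have -> : x / (x + 1) = 1 + - (x + 1)^-1 by field; rewrite gt_eqF.
apply: le_ln1Dx; rewrite ltrN2 invf_lt1//; lra.
Qed.

Lemma logbXn (b n : nat) : (1 < b)%N -> logb b (b%:R ^+ n : R) = n%:R.
Proof.
move=> b1; have lnb : 0 < ln (b%:R : R) by rewrite ln_gt0// ltr1n.
by rewrite /logb lnXn ?ltr0n 1?ltnW// -[_ *+ n]mulr_natl mulfK ?gt_eqF.
Qed.

Lemma ler_logb (b : nat) x y :
  (1 < b)%N -> 0 < x -> x <= y -> logb b x <= logb b y.
Proof.
move=> b1 x0 xy; rewrite /logb ler_pM2r ?invr_gt0 ?ln_gt0 ?ltr1n//.
by rewrite ler_ln ?posrE// (lt_le_trans x0).
Qed.

Lemma logb_le (b : nat) x y : (1 < b)%N -> 0 < x ->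
  (logb b x <= y) = (x <= b%:R `^ y).
Proof.
move=> b1 x0; have b0 : 0 < b%:R :> R by rewrite ltr0n ltnW.
rewrite /logb ler_pdivrMr ?ln_gt0 ?ltr1n// -ln_powR.
by rewrite ler_ln ?posrE ?powR_gt0.
Qed.

Lemma floor_powR_eq (b : nat) (a : int) y : (1 < b)%N -> 0 < a ->
  (Num.floor (b%:R `^ y) == a) =
  (logb b (a%:~R : R) <= y < logb b (a%:~R + 1 : R)).
Proof.
move=> b1 a0; have aR : 0 < a%:~R :> R by rewrite ltr0z.
rewrite floor_eq logb_le// [in RHS]ltNge logb_le//; last by lra.
by rewrite -ltNge intrD.
Qed.

End Logarithms.

Lemma uniform_prob01_itvco (R : realType) (l r : R) :
  0 <= l -> l <= r -> r <= 1 ->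
  uniform_prob (@ltr01 R) `[l, r[ = (r - l)%:E.
Proof.
move=> l0 lr r1; rewrite /uniform_prob (eq_integral (fun=> 1%E)).
  rewrite integral_cst//= lebesgue_measure_itv/= mul1e lte_fin.
  have [//|rl] := ltP l r.
  by rewrite (@le_anti _ _ l r) ?subrr// lr rl.
move=> x; rewrite inE/= in_itv/= => /andP[lx xr].
rewrite /uniform_pdf (le_trans l0 lx) (ltW (lt_le_trans xr r1)).
by rewrite subr0 invr1.
Qed.

Section Significand.
Context {d : measure_display} {T : measurableType d} {R : realType}.
Context {P : probability T R}.
Context {b : nat} (X : {RV P >-> R}).
Hypothesis b1 : (1 < b)%N.

Lemma int_significand_preimage {k : nat} {a : int} : 0 < a ->
  [set w | int_significand b X k w = a] =
  frac_logb b X @^-1` `[logb b a%:~R - (k%:R - 1),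
                        logb b (a%:~R + 1) - (k%:R - 1)[.
Proof.
move=> a0; apply/seteqP; split => w /=;
  rewrite in_itv/= lerBlDr ltrBrDr addrA -floor_powR_eq//; by move/eqP.
Qed.

Lemma significand_support_ge {k : nat} {a : int} :
  significand_support b k a -> b%:R ^+ k.-1 <= a%:~R :> R.
Proof.
by move=> /andP[+ _]; rewrite subn1 -(ler_int R) rmorphXn/= -pmulrn.
Qed.

Lemma significand_support_lt {k : nat} {a : int} :
  significand_support b k a -> a%:~R + 1 <= b%:R ^+ k :> R.
Proof.
move=> /andP[_]; rewrite -lerBrDr -(ler_int R) rmorphB/= rmorphXn/=.
by rewrite -pmulrn.
Qed.

Lemma significand_support_gt0 {k : nat} {a : int} :
  significand_support b k a -> 0 < a.
Proof.
by move=> /andP[+ _]; apply: lt_le_trans; rewrite exprn_gt0// ltz_nat ltnW.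
Qed.

Lemma significand_support_ge_index {k : nat} {a : int} :
  (0 < k)%N -> significand_support b k a -> k%:R <= a%:~R :> R.
Proof.
move=> k0 /significand_support_ge; apply: le_trans.
by rewrite -natrX ler_nat -[leqLHS](prednK k0) ltn_expl.
Qed.

Lemma benford_int_significand_prob {k : nat} {a : int} :
  benford b X -> (0 < k)%N -> significand_support b k a ->
  P [set w | int_significand b X k w = a] =
  ((ln (a%:~R + 1) - ln a%:~R) / ln b%:R)%:E.
Proof.
move=> [_ _ unif] k0 ak; have a0 := significand_support_gt0 ak.
have aR : 0 < a%:~R :> R by rewrite ltr0z.
rewrite int_significand_preimage//.
have := unif `[logb b a%:~R - (k%:R - 1), logb b (a%:~R + 1) - (k%:R - 1)[%classic.
rewrite /distribution /pushforward/= => ->//.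
rewrite uniform_prob01_itvco.
- by congr _%:E; rewrite /logb; lra.
- (* log_b a >= log_b (b ^ (k - 1)) = k - 1 *)
  rewrite subr_ge0 -(@natrB _ k 1)// subn1 -(@logbXn R b)//.
  apply: ler_logb => //; last exact: significand_support_ge.
  by rewrite exprn_gt0// ltr0n ltnW.
- by rewrite lerD2r; apply: ler_logb => //; lra.
- (* log_b (a + 1) <= log_b (b ^ k) = k *)
  rewrite lerBlDr addrCA subrr addr0 -(@logbXn R b)//.
  apply: ler_logb => //; [lra|exact: significand_support_lt].
Qed.

Lemma benford_int_significand_bounds {k : nat} {a : int} :
  benford b X -> (0 < k)%N -> significand_support b k a ->
  (ln b%:R)^-1 * (1 - k.+1%:R^-1) <=
    a%:~R * fine (P [set w | int_significand b X k w = a]) <= (ln b%:R)^-1.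
Proof.
move=> hX k0 ak; rewrite benford_int_significand_prob//=.
have aR : 0 < a%:~R :> R by rewrite ltr0z; exact: significand_support_gt0 ak.
have lnb : 0 < (ln b%:R)^-1 :> R by rewrite invr_gt0 ln_gt0// ltr1n.
have ka : k.+1%:R <= a%:~R + 1 :> R.
  by rewrite -natr1 lerD2r significand_support_ge_index.
set c := a%:~R in aR ka *; rewrite mulrA [X in _ <= X <= _]mulrC.
have c10 : 0 < c + 1 by lra.
rewrite ler_pM2l// ger_pMr//; apply/andP; split.
  apply: (@le_trans _ _ (c * (c + 1)^-1)); last first.
    by rewrite ler_pM2l// ln_succ_ge.
  have -> : c * (c + 1)^-1 = 1 - (c + 1)^-1 by field; rewrite gt_eqF.
  by rewrite lerD2l lerN2 lef_pV2// posrE ltr0n.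
by rewrite -ler_pdivlMl// mulr1 ln_succ_le.
Qed.

End Significand.

Theorem theorem4p1 (d : measure_display) (T : measurableType d) (R : realType)
    (P : probability T R) (b : nat) (X : {RV P >-> R})
    (hb : (2 <= b)%N) (hX : benford b X)
    (a : nat -> int)
    (ha : forall k : nat, (1 <= k)%N -> significand_support b k (a k)) :
  (fun k : nat => (a k)%:~R * fine (P [set w | int_significand b X k w = a k]) : R)
    @ \oo --> (ln b%:R)^-1.
Proof.
apply: (@squeeze_cvgr _ _ _ _
  (fun k => (ln b%:R)^-1 * (1 - harmonic k)) (fun=> (ln b%:R)^-1)).
- near=> k; have k0 : (0 < k)%N by near: k; exact: nbhs_infty_gt.
  by apply: benford_int_significand_bounds => //; exact: ha.
- rewrite -[X in _ --> X]mulr1 -[X in _ * X]subr0.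
  by apply: cvgMr; apply: cvgB; [exact: cvg_cst|exact: cvg_harmonic].
- exact: cvg_cst.
Unshelve. all: by end_near.
Qed.
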